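(* Let $G$ be a $\Theta$-graph which is (up to isomorphism) neither $\Theta_{1,2,2}$ nor any of the graphs $\Theta_{p,p,q}$ with integers $2\leq p\leq 3$ and $p\leq q\leq p+2$. Then $\mathrm{edim}(G)<2c(G)-1$.
   Context: All graphs are finite, simple and connected. A $\Theta$-graph is a graph with precisely two vertices $u,v$ of degree $3$, all other vertices of degree $2$, in which $u$ and $v$ are joined by three internally vertex-disjoint paths. It is denoted $\Theta_{p,q,r}$ when these three paths have lengths (numbers of edges) $p\le q\le r$; since graphs are simple, $q\ge 2$. For vertices $x,y$ of a graph $G$, $d(x,y)$ is the length of a shortest path between them; for a vertex $x$ and an edge $e=yz$, $d(x,e)=\min\{d(x,y),d(x,z)\}$. A vertex $s$ distinguishes two edges $e,e'$ if $d(s,e)\neq d(s,e')$. A set $S\subseteq V(G)$ is an edge metric generator if every pair of distinct edges of $G$ is distinguished by some $s\in S$. The edge metric dimension $\mathrm{edim}(G)$ is the size of a smallest edge metric generator of $G$. The cyclomatic number of $G$ is $c(G)=|E(G)|-|V(G)|+1$. *)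

(* Defs.v *)
From HB Require Import structures.
From mathcomp Require Export all_boot all_order all_algebra.

Set Implicit Arguments.
Unset Strict Implicit.
Unset Printing Implicit Defensive.

Record graph := Graph {
  vertex :> finType;
  adj : rel vertex;
  adj_sym : symmetric adj;
  adj_irr : irreflexive adj;
  adj_conn : forall x y : vertex, connect adj x y
}.

Section Graphs.
Variable G : graph.
Implicit Types (x y z s u v : G) (e : {set G}) (S : {set G}).

(* [x :: p] is a path of G (no repeated vertex) from [x] to [y]; its length is
   [size p]. *)
Definition is_path x y (p : seq G) : bool :=
  [&& path (@adj G) x p, uniq (x :: p) & last x p == y].

Definition deg x : nat := #|[set y | adj x y]|.

Definition edges : {set {set G}} :=
  [set e | [exists x, exists y, adj x y && (e == [set x; y])]].

Definition cyclomatic : int := (#|edges|%:Z - #|G|%:Z + 1)%R.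

Definition path_len x y (n : nat) : bool :=
  [exists p : n.-tuple G, is_path x y p].

Lemma path_lenP x y n :
  reflect (exists2 p : seq G, is_path x y p & size p = n) (path_len x y n).
Proof.
apply: (iffP existsP) => [[p Hp]|[p Hp Hn]].
  by exists (val p) => //; rewrite size_tuple.
by case: _ / Hn; exists (in_tuple p).
Qed.

Lemma ex_path_len x y : exists n, path_len x y n.
Proof.
have /connectP [p pP ->] := adj_conn x y.
case/shortenP: pP => q qP qU _; exists (size q).
by apply/path_lenP; exists q => //; rewrite /is_path qP qU eqxx.
Qed.

Definition dist x y : nat := ex_minn (ex_path_len x y).

Lemma dist_lt_card x y : dist x y < #|G|.
Proof.
rewrite /dist; case: ex_minnP => n /path_lenP [p /and3P[_ pU _] <-] _.
by have := max_card (mem (x :: p)); rewrite (card_uniqP pU).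
Qed.

(* The default value [#|G|] is attained only for the empty set, which is not
   an edge. *)
Definition edist s e : nat := \big[minn/#|G|]_(y in e) dist s y.

Lemma edistE s y z : edist s [set y; z] = minn (dist s y) (dist s z).
Proof.
have minG x : minn (dist s x) #|G| = dist s x.
  by apply/minn_idPl/ltnW/dist_lt_card.
rewrite /edist -big_filter; set r := filter _ _.
have rE x : (x \in r) = (x \in [set y; z]).
  by rewrite mem_filter mem_index_enum andbT.
have lb (t : seq G) x : x \in t ->
    \big[minn/#|G|]_(i <- t) dist s i <= dist s x.
  elim: t => // a t IH; rewrite inE big_cons geq_min.
  by case/predU1P => [->|/IH ->]; rewrite ?leqnn ?orbT.
have glb (t : seq G) m : m <= #|G| -> {in t, forall x, m <= dist s x} ->
    m <= \big[minn/#|G|]_(i <- t) dist s i.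
  move=> mG; elim: t => [|a t IH] H; first by rewrite big_nil.
  rewrite big_cons leq_min H ?mem_head //=; apply: IH => x xt.
  by apply: H; rewrite inE xt orbT.
apply/eqP; rewrite eqn_leq leq_min !lb ?rE ?set21 ?set22 //=.
apply: glb => [|x]; first by rewrite geq_min (ltnW (dist_lt_card s y)).
by rewrite rE => /set2P [] ->; rewrite geq_min leqnn ?orbT.
Qed.

Definition distinguishes s e1 e2 : bool := edist s e1 != edist s e2.

Definition edge_metric_generator S : bool :=
  [forall e1 in edges, forall e2 in edges,
     (e1 != e2) ==> [exists s in S, distinguishes s e1 e2]].

Lemma dist_eq0 x y : (dist x y == 0) = (x == y).
Proof.
rewrite /dist; case: ex_minnP => n /path_lenP [p /and3P[_ _ /eqP pl] <-] H.
apply/eqP/eqP => [/size0nil p0|xy]; first by rewrite -pl p0.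
apply/eqP; rewrite -leqn0; apply: H; apply/path_lenP.
by exists [::]; rewrite // /is_path /= xy eqxx.
Qed.

Lemma edist_eq0 s e : e \in edges -> (edist s e == 0) = (s \in e).
Proof.
rewrite inE => /existsP [x /existsP [y /andP [_ /eqP ->]]].
rewrite edistE !inE -!dist_eq0 -!leqn0 geq_min.
by rewrite !leqn0.
Qed.

Lemma edge_metric_generatorT : edge_metric_generator [set: G].
Proof.
apply/forall_inP => e1 E1; apply/forall_inP => e2 E2; apply/implyP.
apply: contraR => /exists_inPn H; apply/eqP/setP => s.
rewrite -!edist_eq0 //.
by have := H s (in_setT s); rewrite negbK => /eqP ->.
Qed.

Lemma ex_generator_card :
  exists n, [exists S : {set G}, edge_metric_generator S && (#|S| == n)].
Proof.
exists #|[set: G]|; apply/existsP; exists setT.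
by rewrite edge_metric_generatorT eqxx.
Qed.

Definition edim : nat := ex_minn ex_generator_card.

(* [a] is the sequence of internal vertices of a u-v path of length
   [(size a).+1].  The three paths must be pairwise distinct: disjointness of
   the interiors alone would allow the edge uv to be counted twice.  As the
   graph is connected, the degree conditions make the three paths cover all of
   it. *)
Definition is_theta (p q r : nat) : Prop :=
  p <= q <= r /\
  exists u v : G,
    [/\ u != v, deg u = 3, deg v = 3
      & forall w, w != u -> w != v -> deg w = 2] /\
    exists a b c : seq G,
      [/\ is_path u v (rcons a v), is_path u v (rcons b v)
        & is_path u v (rcons c v)] /\
      [/\ uniq (a ++ b ++ c), uniq [:: a; b; c],
          (size a).+1 = p, (size b).+1 = q & (size c).+1 = r].

Definition theta_graph : Prop := exists p q r : nat, is_theta p q r.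

End Graphs.

(* Main.v *)
Require Import Defs.
From mathcomp Require Import zify.

Set Implicit Arguments.
Unset Strict Implicit.
Unset Printing Implicit Defensive.

(** Counting incident pairs (vertex, edge) gives [2 |E| = 2 |V| + 2] for a
    theta graph, so its cyclomatic number is 2 and the claim says that some
    pair of vertices is an edge metric generator.

    Let the three arms, of lengths [p <= q <= r], join [u] to [v], and give
    the vertex at distance [i] from [u] along arm [k] the coordinates [(k, i)],
    with [k = 0, 1, 2].  The degree conditions and connectedness force every
    vertex and every edge to lie on an arm ([theta_coords_exist]).  The
    distance from [(k0, t)] to [(k, i)] is the least length of three routes:
    along the common arm (if [k = k0]), through [u], or through [v]; this is
    [theta_dist], and [dist_coords] identifies it with the graph distance
    because it vanishes only at the source, changes by at most 1 along an edge,
    and decreases along some edge from every other vertex.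

    It remains to exhibit, for all admissible [(p, q, r)], two vertices whose
    distances to an edge determine it ([separating]); halves are rounded down:
    - [r = p + 2] and [2 <= p]: the vertices at distance [p/2] from [u] on the
      shortest and on the longest arm ([separating_half_p]);
    - [p = q], [r = p + 1], [4 <= p]: the neighbour of [u] on arm 0 and the
      vertex at distance [(p + 1)/2] from [u] on arm 1
      ([separating_half_succ_p]);
    - [(1, 2, 3)]: both interior vertices of the longest arm
      ([separating_123]);
    - otherwise, including [(1, 3, 3)]: the vertex at distance [q/2] from [u]
      on arm 1 and the neighbour of [u] on arm 2 ([separating_half_q],
      [separating_133]).
    Each case splits into finitely many systems of linear constraints, according
    to the arms of the two edges and the routes realizing the four distances. *)

(** * Distances in arm coordinates *)

(** The length of arm [k] when the arms have lengths [p], [q], [r]; only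
    [k = 0, 1, 2] is meaningful. *)
Definition arm_len (p q r k : nat) : nat :=
  match k with 0 => p | 1 => q | _ => r end.

(** The length of a shortest arm other than [k0], assuming [p <= q <= r]. *)
Definition detour (p q k0 : nat) := if k0 == 0 then q else p.

(** The distances from the vertex with coordinates [(k0, t)] to the ends [u]
    and [v]. *)
Definition start_dist p q r k0 t :=
  minn t (arm_len p q r k0 - t + detour p q k0).
Definition end_dist p q r k0 t :=
  minn (arm_len p q r k0 - t) (t + detour p q k0).

(** The length of a shortest route from [(k0, t)] to [(k, i)] that enters arm
    [k] through one of its ends. *)
Definition around_dist p q r k0 t k i :=
  minn (start_dist p q r k0 t + i)
       (end_dist p q r k0 t + (arm_len p q r k - i)).

(** The distance from [(k0, t)] to [(k, i)].  The truncated differences add up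
    to the absolute value of [i - t]. *)
Definition theta_dist p q r k0 t k i :=
  if k == k0 then minn ((i - t) + (t - i)) (around_dist p q r k0 t k i)
  else around_dist p q r k0 t k i.

(** The distance from [(k0, t)] to the edge joining [(k, i)] and
    [(k, i.+1)]. *)
Definition theta_edist p q r k0 t k i :=
  minn (theta_dist p q r k0 t k i) (theta_dist p q r k0 t k i.+1).

Lemma theta_dist_start p q r k0 t k : t <= arm_len p q r k0 ->
  p <= q -> q <= r -> k0 < 3 -> k < 3 ->
  theta_dist p q r k0 t k 0 = start_dist p q r k0 t.
Proof.
rewrite /theta_dist /around_dist /start_dist /end_dist /detour.
by case: k0 => [|[|[|]]] //=; case: k => [|[|[|]]] //= => *; lia.
Qed.

Lemma theta_dist_end p q r k0 t k : t <= arm_len p q r k0 ->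
  p <= q -> q <= r -> k0 < 3 -> k < 3 ->
  theta_dist p q r k0 t k (arm_len p q r k) = end_dist p q r k0 t.
Proof.
rewrite /theta_dist /around_dist /start_dist /end_dist /detour.
by case: k0 => [|[|[|]]] //=; case: k => [|[|[|]]] //= => *; lia.
Qed.

Lemma theta_dist_lipschitz p q r k0 t k i :
  theta_dist p q r k0 t k i.+1 <= (theta_dist p q r k0 t k i).+1 /\
  theta_dist p q r k0 t k i <= (theta_dist p q r k0 t k i.+1).+1.
Proof.
rewrite /theta_dist /around_dist.
move: (start_dist _ _ _ _ _) (end_dist _ _ _ _ _) (arm_len _ _ _ _) => du dv l.
by case: eqP => _; lia.
Qed.

(** Every vertex other than the source has a neighbour that is closer to the
    source: along its arm, or, at an end of the arms, along a possibly different
    arm [k']. *)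
Lemma theta_dist_descent p q r k0 t k i n :
  1 <= p -> p <= q -> q <= r -> k0 < 3 -> k < 3 ->
  t <= arm_len p q r k0 -> i <= arm_len p q r k ->
  theta_dist p q r k0 t k i = n.+1 ->
  [\/ i < arm_len p q r k /\ theta_dist p q r k0 t k i.+1 = n,
      0 < i /\ theta_dist p q r k0 t k i.-1 = n,
      i = 0 /\ exists2 k', k' < 3 & theta_dist p q r k0 t k' 1 = n |
      i = arm_len p q r k /\
        exists2 k', k' < 3 &
          theta_dist p q r k0 t k' (arm_len p q r k').-1 = n].
Proof.
move=> h1 h2 h3 k03 k3 tL iL.
have L1 l : 0 < arm_len p q r l by case: l => [|[|l]] /=; lia.
have [->|i0] := posnP i.
  rewrite theta_dist_start // => E; apply: Or43; split=> //.
  have [lt|lt] := leqP t (arm_len p q r k0 - t + detour p q k0).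
    exists k0 => //; move: E.
    rewrite /theta_dist eqxx /around_dist /start_dist /end_dist; lia.
  (* Otherwise a shortest route uses the shortest arm other than [k0]. *)
  exists (if k0 == 0 then 1 else 0); first by case: ifP.
  move: E; rewrite /theta_dist /around_dist /start_dist /end_dist.
  move: lt; rewrite /detour.
  by case: k0 {k03} tL => [|[|k0]] /=; lia.
have [->|/eqP iL'] := eqVneq i (arm_len p q r k).
  rewrite theta_dist_end // => E; apply: Or44; split=> //.
  have [lt|lt] := leqP (arm_len p q r k0 - t) (t + detour p q k0).
    exists k0 => //; have := L1 k0; move: E.
    rewrite /theta_dist eqxx /around_dist /start_dist /end_dist; lia.
  exists (if k0 == 0 then 1 else 0); first by case: ifP.
  move: E; rewrite /theta_dist /around_dist /start_dist /end_dist.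
  move: lt; rewrite /detour.
  by case: k0 {k03} tL => [|[|k0]] /=; lia.
have {iL iL'} iL : i < arm_len p q r k by lia.
move=> E.
suff: theta_dist p q r k0 t k i.+1 = n \/ theta_dist p q r k0 t k i.-1 = n.
  by case=> ?; [apply: Or41|apply: Or42].
move: E; rewrite /theta_dist /around_dist; case: eqP => [kk0|_].
  rewrite -kk0 in tL *.
  move: (start_dist _ _ _ _ _) (end_dist _ _ _ _ _) (arm_len _ _ _ _) iL tL.
  move=> du dv L iL tL E.
  have: i - t + (t - i) = n.+1 \/ du + i = n.+1 \/ dv + (L - i) = n.+1.
    by clear -E; lia.
  case=> [Et|[Eu|Ev]]; [|by right; lia|by left; lia].
  by have [ti|ti] := leqP t i; [right|left]; lia.
move: (start_dist _ _ _ _ _) (end_dist _ _ _ _ _) (arm_len _ _ _ _) iL.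
by move=> du dv L iL; lia.
Qed.

Lemma theta_dist_eq0 p q r k0 t k i :
  1 <= p -> p <= q -> i <= arm_len p q r k -> t <= arm_len p q r k0 ->
  theta_dist p q r k0 t k i = 0 ->
  [\/ k = k0 /\ i = t, i = 0 /\ t = 0
    | i = arm_len p q r k /\ t = arm_len p q r k0].
Proof.
move=> h1 h2 iL tL.
have D : 0 < detour p q k0 by rewrite /detour; case: eqP; lia.
suff O : around_dist p q r k0 t k i = 0 ->
    i = 0 /\ t = 0 \/ i = arm_len p q r k /\ t = arm_len p q r k0.
  rewrite /theta_dist; case: eqP => [kk0|_]; last first.
    by move/O=> []?; [apply: Or32|apply: Or33].
  move=> E; have [/O|?] : around_dist p q r k0 t k i = 0 \/ i = t by lia.
    by case=> ?; [apply: Or32|apply: Or33].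
  by apply: Or31.
rewrite /around_dist /start_dist /end_dist; lia.
Qed.

(** * Pairs of vertices separating all edges *)

(** The vertices [(k1, t1)] and [(k2, t2)] distinguish all pairs of edges, an
    edge being given by its arm and the smaller coordinate of its ends.  By
    symmetry it suffices to consider edges with [k <= k']. *)
Definition separating p q r k1 t1 k2 t2 := forall k k' i i',
  k < 3 -> k' < 3 -> k <= k' -> i < arm_len p q r k -> i' < arm_len p q r k' ->
  theta_edist p q r k1 t1 k i = theta_edist p q r k1 t1 k' i' ->
  theta_edist p q r k2 t2 k i = theta_edist p q r k2 t2 k' i' ->
  k = k' /\ i = i'.

(** A subtraction-free description of the distance [x] from a vertex outside an
    arm of length [L], at distances [du] and [dv] from the ends of that arm, to
    the edge of index [i] on it. *)
Definition out_spec du dv L i x :=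
  (x = du + i /\ du + i + i.+1 <= dv + L) \/
  (x + i.+1 = dv + L /\ dv + L <= du + i + i.+1).

(** The same for a vertex on the arm itself, with coordinate [t]; the edge is
    reached directly or through the end of the arm that lies beyond it. *)
Definition in_spec du dv t L i x :=
  [\/ [/\ x + t = i, t <= i & i + i.+1 <= t + dv + L],
      [/\ x + i.+1 = dv + L, t <= i & t + dv + L <= i + i.+1],
      [/\ x + i.+1 = t, i < t & t <= du + i + i.+1] |
      [/\ x = du + i, i < t & du + i + i.+1 <= t]].

Lemma theta_edist_out p q r k0 t k i : k != k0 -> i < arm_len p q r k ->
  out_spec (start_dist p q r k0 t) (end_dist p q r k0 t) (arm_len p q r k) i
    (theta_edist p q r k0 t k i).
Proof.
move=> kk0 iL; rewrite /theta_edist /theta_dist (negbTE kk0) /around_dist.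
rewrite /out_spec.
move: (start_dist _ _ _ _ _) (end_dist _ _ _ _ _) (arm_len _ _ _ _) iL.
move=> du dv L iL; lia.
Qed.

Lemma theta_edist_in p q r k0 t i :
  t <= arm_len p q r k0 -> i < arm_len p q r k0 ->
  in_spec (start_dist p q r k0 t) (end_dist p q r k0 t) t (arm_len p q r k0) i
    (theta_edist p q r k0 t k0 i).
Proof.
move=> tL iL /=; rewrite /theta_edist /theta_dist eqxx /around_dist.
have : start_dist p q r k0 t <= t by rewrite /start_dist; lia.
have : end_dist p q r k0 t <= arm_len p q r k0 - t by rewrite /end_dist; lia.
move: (start_dist _ _ _ _ _) (end_dist _ _ _ _ _) (arm_len _ _ _ _) tL iL.
move=> du dv L tL iL H1 H2.
have [it|it] := leqP t i.
  have [h|h] := leqP (i + i.+1) (t + dv + L).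
    by apply: Or41; split; lia.
  by apply: Or42; split; lia.
have [h|h] := leqP t (du + i + i.+1); first by apply: Or43; split; lia.
by apply: Or44; split; lia.
Qed.

(** The two descriptions combined, for a source on arm [k0]. *)
Definition edge_spec p q r k0 t du dv k i x :=
  if k == k0 then in_spec du dv t (arm_len p q r k) i x
  else out_spec du dv (arm_len p q r k) i x.

Lemma separating_spec p q r k1 t1 k2 t2 du1 dv1 du2 dv2 :
  t1 <= arm_len p q r k1 -> t2 <= arm_len p q r k2 ->
  start_dist p q r k1 t1 = du1 -> end_dist p q r k1 t1 = dv1 ->
  start_dist p q r k2 t2 = du2 -> end_dist p q r k2 t2 = dv2 ->
  (forall k k' i i' x y, k < 3 -> k' < 3 -> k <= k' ->
     i < arm_len p q r k -> i' < arm_len p q r k' ->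
     edge_spec p q r k1 t1 du1 dv1 k i x ->
     edge_spec p q r k1 t1 du1 dv1 k' i' x ->
     edge_spec p q r k2 t2 du2 dv2 k i y ->
     edge_spec p q r k2 t2 du2 dv2 k' i' y ->
     k = k' /\ i = i') ->
  separating p q r k1 t1 k2 t2.
Proof.
move=> tL1 tL2 <- <- <- <- H k k' i i' k3 k3' kk' iL iL' Q1 Q2.
have C k0 t l j : t <= arm_len p q r k0 -> j < arm_len p q r l ->
    edge_spec p q r k0 t (start_dist p q r k0 t) (end_dist p q r k0 t) l j
      (theta_edist p q r k0 t l j).
  move=> tL jL; rewrite /edge_spec; case: eqP => [lk0|/eqP lk0].
    by move: jL; rewrite lk0 => jL; apply: theta_edist_in.
  exact: theta_edist_out.
apply: (H _ _ _ _ _ _ k3 k3' kk' iL iL' (C _ _ _ _ tL1 iL) _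
          (C _ _ _ _ tL2 iL)).
  by rewrite Q1; apply: C.
by rewrite Q2; apply: C.
Qed.

(* [spec_lia] splits on the routes realizing the four distances; [sep_lia]
   first splits on the arms of the two edges. *)
Ltac spec_lia :=
  match goal with
  | H : out_spec _ _ _ _ _ |- _ => case: H => H; spec_lia
  | H : in_spec _ _ _ _ _ _ |- _ => case: H => H; spec_lia
  | H : _ /\ _ |- _ => case: H => ? ?; spec_lia
  | H : [/\ _, _ & _] |- _ => case: H => ? ? ?; spec_lia
  | _ => first [exfalso; lia | lia]
  end.

Ltac sep_lia :=
  let C1 := fresh "C" in let C2 := fresh "C" in
  let C3 := fresh "C" in let C4 := fresh "C" in
  case=> [|[|[|?]]] [|[|[|?]]] i i' x y // _ _ _;
  rewrite /edge_spec /= => ? ? C1 C2 C3 C4; spec_lia.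

Lemma half_split n : exists h e, [/\ n./2 = h, n = h + h + e & e <= 1].
Proof. by exists n./2, (n - n./2 - n./2); split=> //; lia. Qed.

Lemma separating_half_q p q r :
  1 <= p -> 2 <= q -> p <= q -> q <= r ->
  r <> p.+2 -> ~ (p = q /\ r = p.+1) ->
  ~ (p = 1 /\ r = 2) -> ~ (p = 2 /\ r = 2) -> ~ (p = 3 /\ r = 3) ->
  separating p q r 1 (q./2) 2 1.
Proof.
move=> h1 h2 h3 h4 h5 h6 h7 h8 h9.
have [h [e [-> Hq He]]] := half_split q.
(* The vertex at distance 1 from [u] on arm 2 reaches [v] along that arm if
   [r <= p + 2], and through [u] otherwise. *)
have [rp|rp] := leqP r p.+1.
- apply: (@separating_spec _ _ _ _ _ _ _ h (q - h) 1 r.-1);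
    rewrite /start_dist /end_dist /detour /arm_len /=; try lia.
  have [[? ?]|[? ?]] : (r = p /\ q = p) \/ r = q /\ r = p.+1 by lia.
    clear h3 h4 h5 h6. sep_lia.
  clear h3 h4 h5 h6. sep_lia.
- apply: (@separating_spec _ _ _ _ _ _ _ h (q - h) 1 p.+1);
    rewrite /start_dist /end_dist /detour /arm_len /=; try lia.
  have h56 : p + 2 < r by lia.
  clear h5 h6 h7 h8 h9. sep_lia.
Qed.

Lemma separating_half_p p q :
  2 <= p -> p <= q -> q <= p.+2 -> ~ (p = 2 /\ q = 2) -> ~ (p = 3 /\ q = 3) ->
  separating p q p.+2 0 (p./2) 2 (p./2).
Proof.
move=> h1 h2 h3 h4 h5.
have [h [e [-> Hp He]]] := half_split p.
apply: (@separating_spec _ _ _ _ _ _ _ h (p - h) h (p.+2 - h));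
  rewrite /start_dist /end_dist /detour /arm_len /=; try lia.
sep_lia.
Qed.

Lemma separating_half_succ_p p : 4 <= p -> separating p p p.+1 0 1 1 (p.+1./2).
Proof.
move=> h1.
have [h [e [-> Hp He]]] := half_split p.+1.
apply: (@separating_spec _ _ _ _ _ _ _ 1 p.-1 h (p - h));
  rewrite /start_dist /end_dist /detour /arm_len /=; try lia.
sep_lia.
Qed.

Lemma separating_123 : separating 1 2 3 2 1 2 2.
Proof. by move=> [|[|[|?]]] [|[|[|?]]] [|[|[|?]]] [|[|[|?]]]. Qed.

Lemma separating_133 : separating 1 3 3 1 1 2 1.
Proof. by move=> [|[|[|?]]] [|[|[|?]]] [|[|[|?]]] [|[|[|?]]]. Qed.

(** * Degrees and the cyclomatic number *)

Section Graphs.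
Variable G : graph.

Lemma edgesP (e : {set G}) :
  reflect (exists x y, adj x y /\ e = [set x; y]) (e \in edges G).
Proof.
rewrite inE; apply: (iffP existsP) => [[x /existsP[y]]|[x [y [xy ->]]]].
  by case/andP=> xy /eqP ->; exists x, y.
by exists x; apply/existsP; exists y; rewrite xy eqxx.
Qed.

Lemma card_edge (e : {set G}) : e \in edges G -> #|e| = 2.
Proof.
case/edgesP=> x [y [xy ->]]; rewrite cards2.
by case: eqP xy => // ->; rewrite adj_irr.
Qed.

Lemma deg_incident (x : G) : deg x = #|[set e in edges G | x \in e]|.
Proof.
have -> : [set e in edges G | x \in e] =
    (fun y => [set x; y]) @: [set y | adj x y].
  apply/setP=> e; rewrite inE; apply/andP/imsetP.
    case=> /edgesP[y [z [yz ->]]] /set2P[->|->].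
      by exists z; rewrite ?inE.
    by exists y; rewrite ?inE 1?adj_sym // setUC.
  case=> y; rewrite inE => xy ->; split; last exact: set21.
  by apply/edgesP; exists x, y.
rewrite card_in_imset // => y z; rewrite !inE => xy xz /setP /(_ y).
rewrite !inE eqxx orbT => /esym/orP[]/eqP // yx.
by rewrite yx adj_irr in xy.
Qed.

Lemma sum_deg : \sum_(x : G) deg x = 2 * #|edges G|.
Proof.
transitivity (\sum_(e in edges G) #|e|); last first.
  by rewrite mulnC -sum_nat_const; apply: eq_bigr => e /card_edge.
transitivity (\sum_(x : G) \sum_(e in edges G) (x \in e : nat)).
  apply: eq_bigr => x _; rewrite deg_incident -sum1_card.
  rewrite big_mkcond [RHS]big_mkcond /=.
  by apply: eq_bigr => e _; rewrite inE; case: (e \in edges G); case: (x \in e).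
rewrite exchange_big; apply: eq_bigr => e _.
by rewrite -sum1_card [RHS]big_mkcond; apply: eq_bigr => x _; case: (x \in e).
Qed.

Lemma cyclomatic_theta p q r : is_theta G p q r -> cyclomatic G = 2%R.
Proof.
case=> _ [u [v [[uv du dv d2] _]]].
have := sum_deg; rewrite (bigD1 u) //= (bigD1 v) ?(eq_sym v) //= du dv.
rewrite (eq_bigr (fun=> 2)); last by move=> w /andP[wu wv]; exact: d2.
rewrite sum_nat_const.
have -> : #|[pred w | (w != u) && (w != v)]| = #|G| - 2.
  have <- : #|[set: G] :\: [set u; v]| = #|G| - 2.
    by rewrite cardsD setTI cardsT cards2 uv.
  by apply: eq_card => w; rewrite !inE negb_or andbT.
have : #|[set u; v]| <= #|[set: G]| by rewrite subset_leq_card ?subsetT.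
rewrite cards2 uv cardsT.
rewrite /cyclomatic; move: #|edges G| #|G| => m n *; lia.
Qed.

(** * Coordinates on a theta graph *)

(** A function is the distance from [s] as soon as it vanishes exactly at [s],
    grows by at most 1 along each edge, and decreases along some edge at every
    vertex where it is positive. *)
Lemma dist_potential (s : G) (f : G -> nat) :
  f s = 0 -> (forall x, f x = 0 -> x = s) ->
  (forall x y, adj x y -> f y <= (f x).+1) ->
  (forall x n, f x = n.+1 -> exists2 y, adj x y & f y = n) ->
  dist s =1 f.
Proof.
move=> fs f0 fL fD x; apply/eqP; rewrite eqn_leq; apply/andP; split.
  have [w [pw lw <-]] : exists w,
      [/\ path (@adj G) s w, last s w = x & size w = f x].
    have [n] := ubnP (f x); elim: n x => // n IH x /ltnSE le_n.
    case E: (f x) => [|m].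
      by exists [::]; split=> //; rewrite (f0 _ E).
    have [y xy fy] := fD _ _ E.
    case: (IH y) => [|w [pw lw sw]]; first by rewrite fy -E.
    exists (rcons w x); rewrite rcons_path last_rcons size_rcons pw lw sw fy.
    by rewrite adj_sym xy.
  case/shortenP: pw lw => w' pw' uw' sub lw.
  have le : size w' <= size w by apply: uniq_leq_size sub; case/andP: uw'.
  rewrite (leq_trans _ le) // /dist; case: ex_minnP => m _; apply.
  by apply/path_lenP; exists w' => //; rewrite /is_path pw' uw' lw eqxx.
rewrite /dist; case: ex_minnP => m /path_lenP[w /and3P[pw _ /eqP <-] <-] _.
have {pw}: f (last s w) <= f s + size w.
  elim/last_ind: w pw => [|w y IH]; first by rewrite addn0.
  rewrite rcons_path last_rcons size_rcons => /andP[/IH le /fL le'].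
  by apply: (leq_trans le'); rewrite addnS.
by rewrite fs.
Qed.

(** [pos k i] is the vertex at distance [i] from the common start of the arms
    along arm [k]: the arms, of lengths [p], [q], [r], have the same ends, are
    otherwise disjoint and without repetition, and cover all vertices and
    edges. *)
Record theta_coords p q r (pos : nat -> nat -> G) : Prop := ThetaCoords {
  coords_adj : forall k i, k < 3 -> i < arm_len p q r k ->
    adj (pos k i) (pos k i.+1);
  coords_vertex : forall x, exists k i,
    [/\ k < 3, i <= arm_len p q r k & x = pos k i];
  coords_edge : forall x y, adj x y -> exists k i,
    [/\ k < 3, i < arm_len p q r k
      & x = pos k i /\ y = pos k i.+1 \/ y = pos k i /\ x = pos k i.+1];
  coords_start : forall k k', k < 3 -> k' < 3 -> pos k 0 = pos k' 0;
  coords_end : forall k k', k < 3 -> k' < 3 ->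
    pos k (arm_len p q r k) = pos k' (arm_len p q r k');
  coords_inj : forall k k' i i', k < 3 -> k' < 3 -> i <= arm_len p q r k ->
    i' <= arm_len p q r k' -> pos k i = pos k' i' ->
    [\/ k = k' /\ i = i', i = 0 /\ i' = 0
      | i = arm_len p q r k /\ i' = arm_len p q r k'] }.

Lemma dist_coords p q r pos k0 t k i : theta_coords p q r pos ->
  1 <= p -> p <= q -> q <= r -> k0 < 3 -> k < 3 ->
  t <= arm_len p q r k0 -> i <= arm_len p q r k ->
  dist (pos k0 t) (pos k i) = theta_dist p q r k0 t k i.
Proof.
move=> C h1 h2 h3 k03 k3 tL iL.
have [f fP] : exists f : G -> nat, forall x, exists k i,
    [/\ k < 3, i <= arm_len p q r k, x = pos k i
      & f x = theta_dist p q r k0 t k i].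
  apply: (fin_all_exists (P := fun x n => exists k i,
    [/\ k < 3, i <= arm_len p q r k, x = pos k i
      & n = theta_dist p q r k0 t k i])).
  move=> x; have [l [j [l3 jL ->]]] := coords_vertex C x.
  by exists (theta_dist p q r k0 t l j), l, j.
have fE l j : l < 3 -> j <= arm_len p q r l ->
    f (pos l j) = theta_dist p q r k0 t l j.
  move=> l3 jL; have [l' [j' [l'3 j'L E ->]]] := fP (pos l j).
  case: (coords_inj C l3 l'3 jL j'L E) => -[-> ->] //.
    by rewrite !theta_dist_start.
  by rewrite !theta_dist_end.
have L1 l : 0 < arm_len p q r l by case: l => [|[|l]] /=; lia.
rewrite -fE //; apply: dist_potential => {k i k3 iL} [|x|x y|x n].
- by rewrite fE // /theta_dist eqxx; lia.
- have [k [i [k3 iL -> ->]]] := fP x => /theta_dist_eq0; case=> // -[-> ->] //.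
    exact: coords_start C _ _ _ _.
  exact: coords_end C _ _ _ _.
- case/(coords_edge C) => k [i [k3 iL [] [-> ->]]]; rewrite !fE ?(ltnW iL) //.
    by case: (theta_dist_lipschitz p q r k0 t k i).
  by case: (theta_dist_lipschitz p q r k0 t k i).
have [k [i [k3 iL -> ->]]] := fP x => E.
case: (theta_dist_descent h1 h2 h3 k03 k3 tL iL E) =>
  [[lt E']|[i0 E']|[i0 [l l3 E']]|[i0 [l l3 E']]].
- by exists (pos k i.+1); rewrite ?fE //; apply: coords_adj C _ _ _ _.
- exists (pos k i.-1); rewrite ?fE //; last by lia.
  rewrite adj_sym -{2}(prednK i0).
  by apply: coords_adj C _ _ _ _; rewrite ?prednK.
- exists (pos l 1); rewrite ?fE // i0 (coords_start C k3 l3).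
  exact: coords_adj C _ _ _ _.
exists (pos l (arm_len p q r l).-1); rewrite ?fE ?leq_pred // i0.
rewrite (coords_end C k3 l3).
rewrite adj_sym -{2}(prednK (L1 l)).
by apply: coords_adj C _ _ _ _; rewrite ?prednK.
Qed.

Lemma separating_generator p q r pos k1 t1 k2 t2 : theta_coords p q r pos ->
  1 <= p -> p <= q -> q <= r -> k1 < 3 -> k2 < 3 ->
  t1 <= arm_len p q r k1 -> t2 <= arm_len p q r k2 ->
  separating p q r k1 t1 k2 t2 ->
  edge_metric_generator [set pos k1 t1; pos k2 t2].
Proof.
move=> C h1 h2 h3 k13 k23 tL1 tL2 S.
have E e : e \in edges G -> exists k i,
    [/\ k < 3, i < arm_len p q r k & e = [set pos k i; pos k i.+1]].
  case/edgesP=> x [y [/(coords_edge C)[k [i [k3 iL D]]] ->]].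
  exists k, i; split=> //.
  by case: D => -[-> ->] //; rewrite setUC.
have ED k0 t k i :
    k0 < 3 -> t <= arm_len p q r k0 -> k < 3 -> i < arm_len p q r k ->
    edist (pos k0 t) [set pos k i; pos k i.+1] = theta_edist p q r k0 t k i.
  by move=> *; rewrite edistE !(dist_coords C) // ltnW.
apply/forall_inP=> e /E[k [i [k3 iL ->]]].
apply/forall_inP=> e' /E[k' [i' [k'3 i'L ->]]].
apply/implyP; apply: contraR => /exists_inPn H.
have := H _ (set21 _ _); have := H _ (set22 _ _).
rewrite /distinguishes !negbK !ED // => /eqP E2 /eqP E1.
have [kk|kk] := leqP k k'.
  by have [-> ->] := S _ _ _ _ k3 k'3 kk iL i'L E1 E2.
by have [-> ->] := S _ _ _ _ k'3 k3 (ltnW kk) i'L iL (esym E1) (esym E2).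
Qed.

Lemma edim_le (S : {set G}) : edge_metric_generator S -> edim G <= #|S|.
Proof.
move=> H; rewrite /edim; case: ex_minnP => m _; apply.
by apply/existsP; exists S; rewrite H eqxx.
Qed.

End Graphs.

Lemma neighbours_mem (G : graph) (x y : G) (s : seq G) :
  uniq s -> all (@adj G x) s -> size s = deg x -> adj x y -> y \in s.
Proof.
move=> Us /allP As ss xy.
have /eqP E : [set z in s] == [set z | adj x z].
  rewrite eqEcard; apply/andP; split.
    by apply/subsetP=> z; rewrite !inE; apply: As.
  have -> : #|[set z in s]| = size s by rewrite cardsE; apply/card_uniqP.
  by rewrite ss.
by have := in_set (fun z => adj x z) y; rewrite -E inE xy.
Qed.

(** All neighbours of an arm vertex are among its neighbours on the arms, since
    there are already as many of these as its degree; by connectedness the arms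
    then cover the graph. *)
Lemma theta_coords_exist (G : graph) p q r : is_theta G p q r ->
  exists pos : nat -> nat -> G, theta_coords p q r pos.
Proof.
case=> _ [u [v [[uv du dv d2] [a [b [c [[Pa Pb Pc] [Uabc Dabc sa sb sc]]]]]]]].
pose w k := match k with 0 => a | 1 => b | _ => c end.
pose L := arm_len p q r; pose pos k i := nth v (u :: w k) i.
have wP k : is_path u v (rcons (w k) v) by case: k => [|[|k]].
have wL k : (size (w k)).+1 = L k by case: k => [|[|k]].
have wD k k' x : k < 3 -> k' < 3 -> x \in w k -> x \in w k' -> k = k'.
  move: Uabc; rewrite !cat_uniq has_cat negb_or.
  case/and5P=> _ /andP[/hasPn ab /hasPn ac] _ /hasPn bc _.
  case: k => [|[|[|]]] //; case: k' => [|[|[|]]] //= _ _ x1 x2.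
  - by move: (ab _ x2); rewrite /= x1.
  - by move: (ac _ x2); rewrite /= x1.
  - by move: (ab _ x1); rewrite /= x2.
  - by move: (bc _ x2); rewrite /= x1.
  - by move: (ac _ x1); rewrite /= x2.
  - by move: (bc _ x1); rewrite /= x2.
(* As the arms are distinct, at most one of them is the single edge [uv]. *)
have wN k k' : k < 3 -> k' < 3 -> L k = 1 -> L k' = 1 -> k = k'.
  rewrite -!wL => k3 k3' [/size0nil e1] [/size0nil e2].
  move: Dabc k3 k3' e1 e2; rewrite /= !inE negb_or andbT.
  case/andP=> /andP[/eqP ? /eqP ?] /eqP ?.
  by case: k => [|[|[|]]] //; case: k' => [|[|[|]]] //= _ _ e1 e2; congruence.
have posE k i : pos k i = nth v (u :: rcons (w k) v) i.
  by case: i => //= i; rewrite nth_rcons_default.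
have pos0 k : pos k 0 = u by [].
have posL k : pos k (L k) = v by rewrite -wL /pos /= nth_default.
have wU k : uniq (u :: rcons (w k) v) by case/and3P: (wP k).
have pos_w k i : 0 < i -> i < L k -> pos k i \in w k.
  by case: i => // i _; rewrite -wL ltnS => lt; apply: mem_nth.
have pos_same k i j : i <= L k -> j <= L k -> pos k i = pos k j -> i = j.
  rewrite !posE -wL => iL jL /eqP.
  by rewrite nth_uniq // ?[size _]/= ?size_rcons ?ltnS // => /eqP.
have unotw k : u \notin w k.
  by have := wU k; rewrite /= mem_rcons inE negb_or => /andP[/andP[]].
have vnotw k : v \notin w k.
  by have := wU k; rewrite /= rcons_uniq => /andP[_ /andP[]].
have posI k k' i i' : k < 3 -> k' < 3 -> i <= L k -> i' <= L k' ->
    pos k i = pos k' i' ->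
    [\/ k = k' /\ i = i', i = 0 /\ i' = 0 | i = L k /\ i' = L k'].
  move=> k3 k'3 iL i'L E.
  have [kk|kk] := eqVneq k k'.
    by subst k'; apply: Or31; split=> //; apply: pos_same E.
  have [i0|i0] := posnP i.
    apply: Or32; split=> //; apply: (@pos_same k') => //.
    by rewrite -E i0.
  have [iL'|iL'] := eqVneq i (L k).
    apply: Or33; split=> //; apply: (@pos_same k') => //.
    by rewrite -E iL' !posL.
  have iw : pos k i \in w k by apply: pos_w; lia.
  have [i'0|i'0] := posnP i'.
    by move: iw; rewrite E i'0 pos0 (negbTE (unotw k)).
  have [i'L'|i'L'] := eqVneq i' (L k').
    by move: iw; rewrite E i'L' posL (negbTE (vnotw k)).
  have i'w : pos k' i' \in w k' by apply: pos_w; lia.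
  by rewrite -E in i'w; rewrite (wD _ _ _ k3 k'3 iw i'w) eqxx in kk.
have posA k i : k < 3 -> i < L k -> adj (pos k i) (pos k i.+1).
  move=> k3 iL; have /and3P[/(pathP v) + _ _] := wP k.
  rewrite size_rcons wL => /(_ i iL).
  by rewrite !posE.
have L0 k : 0 < L k by rewrite -wL.
(* The neighbours of [u], of [v], and of an interior vertex of an arm. *)
have Nu y : adj u y -> exists2 k, k < 3 & y = pos k 1.
  move=> uy; have: y \in [:: pos 0 1; pos 1 1; pos 2 1].
    have D k k' : k < k' -> k' < 3 -> pos k 1 != pos k' 1.
      move=> kk k'3; have k3 := ltn_trans kk k'3; apply/eqP => /posI.
      case; rewrite ?L0 //; [by lia|by lia|case=> l1 l2].
      by have := wN k k' k3 k'3 (esym l1) (esym l2); lia.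
    apply: (neighbours_mem (x := u)); rewrite ?du //=.
      by rewrite !inE negb_or !D.
    by rewrite -{1}(pos0 0) -{1}(pos0 1) -{1}(pos0 2) !posA ?L0.
  by rewrite !inE => /or3P[] /eqP ->; [exists 0|exists 1|exists 2].
have posA' k : k < 3 -> adj v (pos k (L k).-1).
  by move=> k3; rewrite adj_sym -(posL k) -{2}(prednK (L0 k)) posA ?prednK.
have Nv y : adj v y -> exists2 k, k < 3 & y = pos k (L k).-1.
  move=> vy; have: y \in [:: pos 0 (L 0).-1; pos 1 (L 1).-1; pos 2 (L 2).-1].
    have D k k' : k < k' -> k' < 3 -> pos k (L k).-1 != pos k' (L k').-1.
      move=> kk k'3; have k3 := ltn_trans kk k'3; apply/eqP => /posI.
      have := L0 k; have := L0 k' => l2 l1.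
      case; rewrite ?leq_pred //; [by lia|case=> e1 e2|by lia].
      by have := wN k k' k3 k'3 ltac:(lia) ltac:(lia); lia.
    apply: (neighbours_mem (x := v)); rewrite ?dv //.
      by rewrite /= !inE negb_or !D.
    by rewrite /= !posA'.
  by rewrite !inE => /or3P[] /eqP ->; [exists 0|exists 1|exists 2].
have Nw k i y : k < 3 -> 0 < i -> i < L k -> adj (pos k i) y ->
    y = pos k i.-1 \/ y = pos k i.+1.
  move=> k3 i0 iL xy; have iw := pos_w _ _ i0 iL.
  suff: y \in [:: pos k i.-1; pos k i.+1].
    by rewrite !inE => /orP[]/eqP ->; [left|right].
  apply: neighbours_mem xy.
  - rewrite /= inE andbT; apply/eqP => /pos_same; lia.
  - rewrite /= andbT posA // andbT adj_sym -{2}(prednK i0) posA //.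
    by rewrite prednK // ltnW.
  by rewrite d2 //; apply: contraTneq iw => ->.
pose on x y := exists k i, [/\ k < 3, i < L k
    & x = pos k i /\ y = pos k i.+1 \/ y = pos k i /\ x = pos k i.+1].
have E1 k i y : k < 3 -> i <= L k -> adj (pos k i) y -> on (pos k i) y.
  move=> k3 iL; have [->|i0] := posnP i.
    rewrite pos0 => /Nu[l l3 ->]; exists l, 0.
    by split; rewrite ?L0 //; left.
  have [->|iL'] := eqVneq i (L k).
    rewrite posL => /Nv[l l3 ->]; exists l, (L l).-1.
    split=> //; first by rewrite prednK.
    by right; rewrite prednK // posL.
  have {iL iL'} iL : i < L k by lia.
  case/(Nw _ _ _ k3 i0 iL) => ->.
    by exists k, i.-1; split=> //; [lia|right; rewrite prednK].
  by exists k, i; split=> //; left.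
pose inW x := exists k i, [/\ k < 3, i <= L k & x = pos k i].
have E2 x y : inW x -> adj x y -> on x y by case=> k [i [k3 iL ->]]; apply: E1.
have W x : inW x.
  have /connectP[s ps ->] := adj_conn u x.
  have : inW u by exists 0, 0.
  elim: s (u) ps => [|y s IH] z //= /andP[zy ys] zW.
  apply: IH => //; have [k [i [k3 iL [[_ ->]|[-> _]]]]] := E2 _ _ zW zy.
    by exists k, i.+1.
  by exists k, i; split=> //; apply: ltnW.
exists pos; split=> //.
- by move=> x y; apply: E2.
- by move=> k k' _ _; rewrite !posL.
Qed.

Lemma theta_lengths (G : graph) p q r : is_theta G p q r ->
  [/\ 1 <= p, 2 <= q, p <= q & q <= r].
Proof.
case=> /andP[pq qr] [u [v [_ [a [b [c [_ [_ D sa sb _]]]]]]]].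
split=> //; first by rewrite -sa.
rewrite ltnNge; apply/negP => q1.
have /size0nil a0 : size a = 0 by lia.
have /size0nil b0 : size b = 0 by lia.
by rewrite a0 b0 in D.
Qed.

Theorem corollary18 (G : graph) (hG : theta_graph G)
    (h122 : ~ is_theta G 1 2 2)
    (hppq : forall p q : nat, 2 <= p <= 3 -> p <= q <= p + 2 ->
              ~ is_theta G p p q) :
  ((edim G)%:Z < 2 * cyclomatic G - 1)%R.
Proof.
case: hG => p [q [r T]].
rewrite (cyclomatic_theta T).
suff: edim G <= 2 by lia.
have [p1 q2 pq qr] := theta_lengths T.
have [pos C] := theta_coords_exist T.
have bound k1 t1 k2 t2 : k1 < 3 -> k2 < 3 -> t1 <= arm_len p q r k1 ->
    t2 <= arm_len p q r k2 -> separating p q r k1 t1 k2 t2 -> edim G <= 2.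
  move=> k13 k23 t1L t2L S.
  have := edim_le (separating_generator C p1 pq qr k13 k23 t1L t2L S).
  by move/leq_trans; apply; rewrite cards2; case: eqP.
have n122 : ~ (p = 1 /\ q = 2 /\ r = 2).
  by case=> ep [eq er]; subst; apply: h122.
have nppq : ~ (p = q /\ 2 <= p <= 3 /\ r <= p + 2).
  by case=> epq [p23 rp]; subst q; apply: (hppq p r) => //; rewrite qr.
have [rp2|rp2] := eqVneq r p.+2.
  have [p2|p2] := leqP 2 p.
    apply: (bound 0 p./2 2 p./2) => //; try by rewrite /=; lia.
    by rewrite rp2; apply: separating_half_p; lia.
  have ep : p = 1 by lia.
  rewrite {}ep in rp2 bound pq; rewrite {}rp2 in bound qr.
  have [q2'|q3] : q = 2 \/ q = 3 by lia.
    by rewrite {}q2' in bound; apply: (bound _ _ _ _ _ _ _ _ separating_123).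
  by rewrite {}q3 in bound; apply: (bound _ _ _ _ _ _ _ _ separating_133).
have [/andP[/eqP epq /eqP er]|ne] := boolP ((p == q) && (r == p.+1)).
  apply: (bound 0 1 1 p.+1./2) => //; first by rewrite /=; lia.
  by rewrite -epq er; apply: separating_half_succ_p; lia.
apply: (bound 1 q./2 2 1) => //; try by rewrite /=; lia.
by apply: separating_half_q; lia.
Qed.
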